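(* The rational points of the projective closure in $\mathbb{P}^2$ of the curve $$C_{14}:\ 2a-3a^2+a^3+ab-b^2=0$$ (with homogeneous coordinates $(a:b:c)$, the affine part being $c=1$) are exactly $$(0:0:1),\ (1:1:1),\ (1:0:1),\ (2:2:1),\ (2:0:1),\ (0:1:0),$$ and no configuration $\mathbb{B}_{14}$ can be obtained over the rational numbers: there is no family $(L_k)_{k\in\mathbb{Z}/14}$ of lines in $\mathbb{P}^2(\mathbb{Q})$ that is a non-degenerate configuration $\mathbb{B}_{14}$.
   Context: A (non-degenerate) configuration $\mathbb{B}_n$ over a field $K$ is a configuration of $n$ lines with the incidences of the original Böröczky configuration of $n$ lines, with all lines and all triple points distinct: i.e. a family $(L_k)_{k\in\mathbb{Z}/n}$ of pairwise distinct lines in $\mathbb{P}^2(K)$ such that for every set $\{i,j,k\}$ of three distinct elements of $\mathbb{Z}/n$ with $i+j+k=0$ the lines $L_i,L_j,L_k$ have a common point $P_{\{i,j,k\}}$, and the points $P_{\{i,j,k\}}$, for different such sets, are pairwise distinct. (The original Böröczky configuration consists of the lines $L_k=Q_\alpha Q_{\pi-2\alpha}$, $\alpha=2k\pi/n$, where $Q_\alpha$ is the point obtained by rotating a fixed point of a circle by $\alpha$ about the center.) *)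

(* Defs.v *)
From HB Require Import structures.
From mathcomp Require Import all_boot all_order all_algebra.
From mathcomp Require Import mpoly.

Set Implicit Arguments.
Unset Strict Implicit.
Unset Printing Implicit Defensive.

Import GRing.Theory.
Local Open Scope ring_scope.

(* The points and lines of P^2(K) are the 1- and 2-dimensional subspaces of   *)
(* K^3; a point lies on a line when it is a subspace of it.                   *)
Definition ppoint (K : fieldType) := {P : {vspace 'rV[K]_3} | \dim P == 1%N}.
Definition pline (K : fieldType) := {L : {vspace 'rV[K]_3} | \dim L == 2%N}.

Definition on_line (K : fieldType) (P : ppoint K) (L : pline K) : bool :=
  (val P <= val L)%VS.

(* The span of (a, b, c); it is the point (a : b : c) only if the coordinates *)
(* are not all zero.                                                          *)
Definition hcoord (K : fieldType) (a b c : K) : {vspace 'rV[K]_3} :=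
  <[\row_(i < 3) [:: a; b; c]`_i]>%VS.

(* c ^ d * p (a / c, b / c), where d = (msize p).-1 is the total degree of p. *)
Definition homogenize (K : fieldType) (p : {mpoly K[2]}) : {mpoly K[3]} :=
  \sum_(m <- msupp p)
     p@_m *: ('X_0 ^+ m 0 * 'X_1 ^+ m 1 * 'X_2 ^+ ((msize p).-1 - mdeg m)%N).

(* The projective closure of the affine plane curve p = 0 is the zero locus   *)
(* of the homogenization of p.                                                *)
Definition on_projective_closure (K : fieldType) (p : {mpoly K[2]})
    (P : ppoint K) : Prop :=
  forall v : 'rV[K]_3, v \in val P -> (homogenize p).@[v 0] = 0.

Definition C14 : {mpoly rat[2]} :=
  let a := 'X_0 in let b := 'X_1 in
  2 * a - 3 * a ^+ 2 + a ^+ 3 + a * b - b ^+ 2.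

(* Z/n is represented by 'I_n, so that i + j + k = 0 in Z/n reads as          *)
(* divisibility by n of the sum of the natural number representatives.        *)
Definition zero_triples (n : nat) : {set {set 'I_n}} :=
  [set T : {set 'I_n} | (#|T| == 3%N) && (n %| \sum_(i in T) (i : nat))%N].

Definition boroczky_config (K : fieldType) (n : nat) (L : 'I_n -> pline K) :
    Prop :=
  injective L /\
  exists P : {set 'I_n} -> ppoint K,
    (forall T : {set 'I_n}, T \in zero_triples n ->
       forall i : 'I_n, i \in T -> on_line (P T) (L i)) /\
    {in zero_triples n &, injective P}.

(* Main.v *)
Require Import Defs.
From HB Require Import structures.
From mathcomp Require Import all_boot all_order all_algebra.
From mathcomp Require Import mpoly.
From mathcomp Require Import zify ring lra.

(** With y = 2b - a the curve becomes y^2 = 4a^3 - 11a^2 + 8a, an elliptic curve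
    of rank 0.  Writing a = p / q and splitting off powers of 2, the rational
    points are reduced to the two quartics
      N^2 = M^4 - 11 M^2 e^2 + 32 e^4   and   N^2 = M^4 + 22 M^2 e^2 - 7 e^4
    (the homogeneous spaces of a 2-isogeny and its dual), and an infinite
    descent on e passes from one quartic to the other.

    For the configuration, let q_k be the normal vector of L_k, so that q_i, q_j,
    q_k are linearly dependent when {i, j, k} is a zero triple, and independent
    when two distinct zero triples are {i, j, _} and {i, k, _}.  Taking q_1, q_2,
    q_3, q_7 as projective frame, q_4 and q_11 depend on one parameter each, a and
    b, which determine q_9, q_8, q_5, q_0 and q_6.  The concurrency of L_0, L_6,
    L_8 then reads a^2 b + a b - a - b^2 = 0.  This is again the curve above, and
    its rational points have a in {0, 1, -1}, where the configuration
    degenerates. *)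

Set Implicit Arguments.
Unset Strict Implicit.
Unset Printing Implicit Defensive.

Import GRing.Theory.
Local Open Scope ring_scope.

(** * Descent in the natural numbers *)

Local Open Scope nat_scope.

(* Terms with a minus sign are moved to the other side of the equations, since
   subtraction on nat is truncated. *)

Lemma expn4 x : x ^ 4 = (x ^ 2) ^ 2. Proof. by rewrite -expnM. Qed.

Lemma odd_sqr_mod8 x : odd x -> exists k, x ^ 2 = 8 * k + 1.
Proof.
move=> ox; have [y ->] : exists y, x = 2 * y + 1.
  by exists x./2; rewrite -{1}[x]odd_double_half ox; lia.
case: (boolP (odd y)) => oy.
  exists (y * (y./2 + 1)); have := odd_double_half y; rewrite oy; nia.
exists (y./2 * (y + 1)); have := odd_double_half y; rewrite (negPf oy); nia.
Qed.

Lemma even_double x : ~~ odd x -> exists y, x = 2 * y.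
Proof. by move=> ex; exists x./2; have := odd_double_half x; rewrite (negPf ex); lia. Qed.

Lemma coprime_by_primes m n :
  (forall p, prime p -> p %| m -> p %| n -> False) -> coprime m n.
Proof.
move=> H; apply/negPn/negP => ncop.
have [g0|g0] := posnP (gcdn m n).
  by apply: (H 2) => //; apply: dvdn_trans (_ : gcdn m n %| _);
    rewrite ?g0 ?dvdn0 // -g0 ?dvdn_gcdl ?dvdn_gcdr.
have g1 : 1 < gcdn m n by move: ncop; rewrite /coprime; lia.
have pd := pdiv_dvd (gcdn m n).
by apply: (H _ (pdiv_prime g1)); apply: dvdn_trans pd _; rewrite ?dvdn_gcdl ?dvdn_gcdr.
Qed.

(** The root is [g = gcdn m c]. With [c = c' * g], the power [c' ^ k] divides [n], and the remaining
    cofactor of [n] divides a power of [g] while being coprime to it, hence is 1. *)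
Lemma coprime_mul_exp m n c k : 0 < k -> coprime m n -> m * n = c ^ k ->
  exists r, m = r ^ k.
Proof.
case: k => // k _ cop; have [-> /eqP|c0 E] := posnP c.
  rewrite exp0n // muln_eq0 => /orP[|] /eqP z; subst.
    by exists 0; rewrite exp0n.
  by exists 1; move: cop; rewrite /coprime gcdn0 exp1n => /eqP.
set g := gcdn m c.
have g0 : 0 < g by rewrite gcdn_gt0 c0 orbT.
have /dvdnP[m' Em] : g %| m by exact: dvdn_gcdl.
have /dvdnP[c' Ec] : g %| c by exact: dvdn_gcdr.
have cop' : coprime m' c'.
  rewrite /coprime -(eqn_pmul2r g0) mul1n muln_gcdl -Em -Ec.
  by rewrite eqxx.
have E1 : m' * n = g ^ k * c' ^ k.+1.
  apply/eqP; rewrite -(eqn_pmul2r g0); apply/eqP.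
  by rewrite mulnAC -Em E {1}Ec expnMn (expnS g); lia.
have c'0 : 0 < c' by move: c0; rewrite Ec muln_gt0 => /andP[].
have /dvdnP[n' En] : c' ^ k.+1 %| n.
  by rewrite -(@Gauss_dvdr _ m') ?E1 ?dvdn_mull // coprime_sym coprimeXr.
have E2 : m' * n' = g ^ k.
  by apply/eqP; rewrite -(@eqn_pmul2r (c' ^ k.+1)) ?expn_gt0 ?c'0 // -mulnA -En E1.
have n'1 : n' = 1.
  apply/eqP; rewrite -dvdn1 -(@Gauss_dvdr _ (g ^ k)).
    by rewrite muln1 -E2 dvdn_mull.
  apply: coprimeXr; apply: (coprime_dvdl (n := n)); first by rewrite En dvdn_mulr.
  by apply: (coprime_dvdr (n := m)); rewrite ?dvdn_gcdl // coprime_sym.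
by exists g; rewrite Em -[m']muln1 -n'1 E2 expnSr.
Qed.

(** By coprimality only one of [U], [V] is divisible by [p], and it absorbs all of [p ^ k]; after
    division the two factors are coprime with product [e ^ n]. *)
Lemma coprime_mul_pfactor p k U V e n : prime p -> 0 < n -> 0 < e ->
  coprime U V -> U * V = p ^ k * e ^ n ->
  exists r s, [/\ coprime r s, e = r * s &
    (U = p ^ k * r ^ n /\ V = s ^ n) \/ (V = p ^ k * r ^ n /\ U = s ^ n)].
Proof.
move=> pp n0 e0.
have main U' V' : coprime U' V' -> U' * V' = p ^ k * e ^ n -> p ^ k %| U' ->
    exists r s, [/\ coprime r s, e = r * s & U' = p ^ k * r ^ n /\ V' = s ^ n].
  move=> cop E /dvdnP[u Eu].
  have pk0 : 0 < p ^ k by rewrite expn_gt0 prime_gt0.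
  have E1 : u * V' = e ^ n.
    by apply/eqP; rewrite -(eqn_pmul2l pk0) mulnA [p ^ k * u]mulnC -Eu E.
  have cop1 : coprime u V' by apply: coprime_dvdl cop; rewrite Eu dvdn_mulr.
  have [r Er] := coprime_mul_exp n0 cop1 E1.
  have [s Es] : exists s, V' = s ^ n.
    by apply: (@coprime_mul_exp _ u e n) => //; rewrite 1?coprime_sym // mulnC.
  exists r, s; split; last by rewrite Eu Er Es mulnC.
    by move: cop1; rewrite Er Es coprime_pexpl // coprime_pexpr.
  by apply/eqP; rewrite -(eqn_exp2r _ _ n0) expnMn -Er -Es E1.
move=> cop E; have [pU|pU] := boolP (p %| U).
  have pV : ~~ (p %| V).
    apply/negP => pV; have : p %| gcdn U V by rewrite dvdn_gcd pU.
    by rewrite (eqP cop) dvdn1 => /eqP p1; move: pp; rewrite p1.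
  have [|r [s [? ? ?]]] := main U V cop E; last by exists r, s; split=> //; left.
  rewrite -(@Gauss_dvdl _ _ V) ?E ?dvdn_mulr //.
  by apply: coprimeXl; rewrite prime_coprime.
have [|||r [s [? ? ?]]] := main V U; last by exists r, s; split=> //; right.
- by rewrite coprime_sym.
- by rewrite mulnC.
rewrite -(@Gauss_dvdr _ U) ?E ?dvdn_mulr //.
by apply: coprimeXl; rewrite prime_coprime.
Qed.

(** [S] and [N] have the same parity, so [C] is the product of the halves of [S - N] and [S + N]. *)
Lemma sqr_diff_half S N C : S ^ 2 = N ^ 2 + 4 * C ->
  exists U, S = N + 2 * U /\ U * (U + N) = C.
Proof.
move=> E; have NS : N <= S by rewrite -leq_sqr E leq_addr.
have [d Ed] : exists d, S = N + d by exists (S - N); rewrite subnKC.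
have /even_double[U EU] : ~~ odd d.
  apply/negP => od; have [k Ek] := odd_sqr_mod8 od.
  by have := odd_double_half d; rewrite od; move: E; rewrite Ed; nia.
by exists U; split; [rewrite Ed EU | move: E; rewrite Ed EU; nia].
Qed.

Lemma prime_coprime_absurd p m n : prime p -> coprime m n -> p %| m -> p %| n -> False.
Proof.
move=> pp cop pm pn; have : p %| gcdn m n by rewrite dvdn_gcd pm.
by rewrite (eqP cop) dvdn1 => /eqP p1; move: pp; rewrite p1.
Qed.

(** As 7 is squarefree, a prime dividing both [X] and [Y] also divides [f]: for the prime 7 itself,
    49 divides [7 * f ^ 4]. *)
Lemma coprime_mul_eq7 X Y f :
  (forall p, prime p -> p %| X -> p %| Y -> p %| f -> False) ->
  X * Y = 7 * f ^ 4 -> coprime X Y.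
Proof.
move=> H E; apply: coprime_by_primes => p pp pX pY.
have : p %| 7 * f ^ 4 by rewrite -E dvdn_mulr.
rewrite Euclid_dvdM // => /orP[p7|]; last by rewrite Euclid_dvdX // => /andP[pf _]; exact: (H p).
have {p7}p7 : p = 7 by apply/eqP; rewrite -dvdn_prime2.
subst p; apply: (H 7) => //.
have : 7 * 7 %| 7 * f ^ 4 by rewrite -E dvdn_mul.
by rewrite dvdn_pmul2l // Euclid_dvdX // => /andP[].
Qed.

(* The two factors of (M^2 + 11 e^2)^2 - N^2 = 128 e^4 are halved and then
   coprime. *)
Lemma quartic_split_of_odd M e N : odd (M + e) -> 0 < e -> coprime M e ->
  N ^ 2 + 7 * e ^ 4 = M ^ 4 + 22 * M ^ 2 * e ^ 2 ->
  exists r s, [/\ coprime r s, e = r * s &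
    M ^ 2 + 11 * (r * s) ^ 2 = 32 * r ^ 4 + s ^ 4].
Proof.
move=> oMe e0 cop E.
have [|U [ES EU]] := @sqr_diff_half (M ^ 2 + 11 * e ^ 2) N (32 * e ^ 4).
  by move: E; rewrite !expn4; clear; lia.
have copU : coprime U (U + N).
  apply: coprime_by_primes => p pp pU pV.
  have pS : p %| M ^ 2 + 11 * e ^ 2.
    by rewrite ES mul2n -addnn addnCA dvdn_addr // addnC.
  have : p %| 32 * e ^ 4 by rewrite -EU dvdn_mulr.
  rewrite Euclid_dvdM // => /orP[|]; last first.
    rewrite Euclid_dvdX // => /andP[pe _].
    move: pS; rewrite dvdn_addl ?Euclid_dvdX ?dvdn_mull ?dvdn_exp //.
    by move=> /andP[pM _]; exact: prime_coprime_absurd cop pM pe.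
  rewrite (_ : 32 = 2 ^ 5) // Euclid_dvdX // dvdn_prime2 // => /andP[/eqP p2 _].
  by move: pS; rewrite p2 dvdn2 oddD oddM !oddX /= -oddD oMe.
have [r [s [crs Ee H]]] := @coprime_mul_pfactor 2 5 _ _ e 4 isT isT e0 copU EU.
exists r, s; split=> //; rewrite -Ee.
by case: H => -[E1 E2]; move: E1 E2 ES; rewrite (_ : 2 ^ 5 = 32) //; clear; lia.
Qed.

(** If [s] were even, then [e] would be even and [M] odd, and the two sides of the new equation
    would differ in parity. If [r] and [s] were both odd, [M ^ 2] would be 2 modulo 4. *)
Lemma quartic_split_even M e N : odd (M + e) -> 0 < e -> coprime M e ->
  N ^ 2 + 7 * e ^ 4 = M ^ 4 + 22 * M ^ 2 * e ^ 2 ->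
  exists f s, [/\ coprime (2 * f) s, e = 2 * f * s, odd s &
    M ^ 2 + 11 * (2 * f * s) ^ 2 = 32 * (2 * f) ^ 4 + s ^ 4].
Proof.
move=> oMe e0 cop E.
have [r [s [crs Ee E1]]] := quartic_split_of_odd oMe e0 cop E.
have os : odd s.
  move: oMe (congr1 odd E1); rewrite Ee !(oddD, oddM, oddX) /=.
  by case: (odd M); case: (odd r); case: (odd s).
have er : ~~ odd r.
  apply/negP => /odd_sqr_mod8[i Ei]; have [j Ej] := odd_sqr_mod8 os.
  have [/odd_sqr_mod8[k Ek]|/even_double[k Ek]] := boolP (odd M).
    by move: E1; rewrite !expn4 expnMn Ei Ej Ek; clear; lia.
  by move: E1; rewrite !expn4 expnMn Ei Ej Ek; clear; lia.
by have [f Ef] := even_double er; exists f, s; rewrite -Ef.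
Qed.

(** Modulo 8 the left side is 1 or 2, the right side 0, 5 or 7. *)
Lemma quartic_sign_obstruction s u v : odd s ->
  s ^ 2 + u ^ 4 = 22 * u ^ 2 * v ^ 2 + 7 * v ^ 4 -> False.
Proof.
move=> /odd_sqr_mod8[k Ek]; rewrite !expn4 Ek.
have [/odd_sqr_mod8[i Ei]|/even_double[i Ei]] := boolP (odd u);
have [/odd_sqr_mod8[j Ej]|/even_double[j Ej]] := boolP (odd v);
  by rewrite Ei Ej; clear; lia.
Qed.

Lemma dist_exists m n : exists d, m = n + d \/ n = m + d.
Proof.
case: (leqP m n) => h; first by exists (n - m); right; rewrite subnKC.
by exists (m - n); left; rewrite subnKC // ltnW.
Qed.

(* M^2 = d^2 + 28 f^4 with d = |s^2 - 22 f^2|, and M^2 - d^2 is factored; the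
   two possible signs of s^2 - 22 f^2 are separated modulo 8. *)
Lemma quartic_split_32 M f s : odd s -> 0 < f -> coprime (2 * f) s ->
  M ^ 2 + 11 * (2 * f * s) ^ 2 = 32 * (2 * f) ^ 4 + s ^ 4 ->
  exists u v, [/\ coprime u v, f = u * v &
    s ^ 2 + 7 * v ^ 4 = u ^ 4 + 22 * u ^ 2 * v ^ 2].
Proof.
move=> os f0 cop E; have [d Hd] := dist_exists (s ^ 2) (22 * f ^ 2).
have [|X [EM EX]] := @sqr_diff_half M d (7 * f ^ 4).
  move: Hd E; rewrite !expn4 !expnMn; move: (f ^ 2) (s ^ 2); clear=> F S [->|EF].
    by lia.
  have -> : d = 22 * F - S by rewrite EF addKn.
  have : S <= 22 * F by rewrite EF leq_addr.
  by clear; nia.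
have copX : coprime X (X + d).
  apply: coprime_mul_eq7 EX => p pp pX; rewrite dvdn_addr // => pd pf.
  have ps : p %| s ^ 2.
    have p22 : p %| 22 * f ^ 2 by rewrite dvdn_mull ?dvdn_exp.
    by case: Hd => Hd; [rewrite Hd dvdn_addl | rewrite -(@dvdn_addl d) // -Hd].
  apply: (prime_coprime_absurd pp cop); first by rewrite dvdn_mull.
  by move: ps; rewrite Euclid_dvdX // => /andP[].
have [v [u [cvu Ef H]]] := @coprime_mul_pfactor 7 1 _ _ f 4 isT isT f0 copX EX.
exists u, v; split; [by rewrite coprime_sym | by rewrite mulnC | ].
have := @quartic_sign_obstruction s u v os.
move: Hd; rewrite Ef expnMn; move: H; rewrite expn1; clear.
(* Either order of the factors [7 * v ^ 4], [u ^ 4] meets either sign of [s ^ 2 - 22 * f ^ 2]: two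
   of the four cases give the equation, the other two the obstruction. *)
by move=> [] [E1 E2] [] E3 bad; first [lia | exfalso; apply: bad; lia].
Qed.

(** Infinite descent: splitting twice leads from [(M, e)] to a solution [(u, v)] of the same
    equation with [e = 2 * u * v * s], so [v < e]. *)
Lemma no_quartic_even M e N : odd M -> 0 < e -> ~~ odd e -> coprime M e ->
  N ^ 2 + 7 * e ^ 4 = M ^ 4 + 22 * M ^ 2 * e ^ 2 -> False.
Proof.
elim/ltn_ind: e M N => e IH M N oM e0 ee cop E.
have [|f [s [cfs Ee os E1]]] := quartic_split_even _ e0 cop E.
  by rewrite oddD oM (negPf ee).
have [f0 s0] : 0 < f /\ 0 < s by apply/andP; move: e0; rewrite Ee !muln_gt0.
have [u [v [cuv Ef E2]]] := quartic_split_32 os f0 cfs E1.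
have [u0 v0] : 0 < u /\ 0 < v by apply/andP; rewrite -muln_gt0 -Ef.
(* Both [u] and [v] odd is impossible modulo 8; if only [v] is odd, another splitting exhibits a
   factor 2 in [v]. *)
have ev : ~~ odd v.
  apply/negP => ov; have [ou|eu] := boolP (odd u).
    move: E2; have [i Ei] := odd_sqr_mod8 ou; have [j Ej] := odd_sqr_mod8 ov.
    have [k Ek] := odd_sqr_mod8 os.
    by rewrite !expn4 Ei Ej Ek; clear; lia.
  have [|f' [s' [_ Ev _ _]]] := quartic_split_even _ v0 cuv E2.
    by rewrite oddD ov (negPf eu).
  by move: ov; rewrite Ev -mulnA oddM.
have ou : odd u.
  apply/negP => /negP eu; have := @prime_coprime_absurd 2 _ _ isT cuv.
  by rewrite !dvdn2 => /(_ eu ev).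
apply: (IH v _ u s ou v0 ev cuv E2); rewrite Ee Ef mulnAC mulnA ltn_Pmull //.
by move: u0 s0; clear; nia.
Qed.

(** The two sides are 1 and 5 modulo 8. *)
Lemma quartic_8_sign_obstruction s u v : odd u -> odd v ->
  16 * s ^ 2 + u ^ 4 = 22 * u ^ 2 * v ^ 2 + 7 * v ^ 4 -> False.
Proof.
move=> /odd_sqr_mod8[i Ei] /odd_sqr_mod8[j Ej].
by rewrite !expn4 Ei Ej; clear; lia.
Qed.

(* Same idea: (4 n)^2 = d^2 + 7 r^4 with d = |8 s^2 - 11 r^2|. *)
Lemma quartic_split_8 n r s : odd r -> coprime r s ->
  n ^ 2 + 11 * (r * s) ^ 2 = 8 * r ^ 4 + 4 * s ^ 4 ->
  exists u v, [/\ coprime u v, r = u * v &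
    (4 * s) ^ 2 + 7 * v ^ 4 = u ^ 4 + 22 * u ^ 2 * v ^ 2].
Proof.
move=> or cop E; have r0 : 0 < r by case: r or {cop E}.
have [d Hd] := dist_exists (8 * s ^ 2) (11 * r ^ 2).
have E16 : (4 * n) ^ 2 = d ^ 2 + 7 * r ^ 4.
  move: Hd E; rewrite !expn4 !expnMn; move: (r ^ 2) (s ^ 2); clear=> R S Hd E.
  case: Hd => Hd.
    have -> : d = 8 * S - 11 * R by rewrite Hd addKn.
    by have := leq_addr d (11 * R); rewrite -Hd; move: E; clear; nia.
  have -> : d = 11 * R - 8 * S by rewrite Hd addKn.
  by have := leq_addr d (8 * S); rewrite -Hd; move: E; clear; nia.
have dn : d <= 4 * n by rewrite -leq_sqr E16 leq_addr.
(* No halving here: since [r] is odd, so are the factors [X = 4 * n - d] and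
   [X + 2 * d = 4 * n + d]. *)
have [X EX] : exists X, 4 * n = d + X by exists (4 * n - d); rewrite subnKC.
have EX7 : X * (X + 2 * d) = 7 * r ^ 4.
  by move: E16; rewrite EX; move: (r ^ 4); clear; nia.
have copX : coprime X (X + 2 * d).
  apply: coprime_mul_eq7 EX7 => p pp pX; rewrite dvdn_addr // => pd pr.
  have p2 : p == 2 = false.
    by apply: contraTF or => /eqP p2; rewrite -dvdn2 -p2.
  have {}pd : p %| d by move: pd; rewrite Euclid_dvdM // dvdn_prime2 // p2.
  have ps : p %| 2 ^ 3 * s ^ 2.
    have p11 : p %| 11 * r ^ 2 by rewrite dvdn_mull ?dvdn_exp.
    by case: Hd => Hd; [rewrite Hd dvdn_addl | rewrite -(@dvdn_addl d) // -Hd].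
  apply: (prime_coprime_absurd pp cop) => //.
  move: ps; rewrite Euclid_dvdM // !Euclid_dvdX // dvdn_prime2 // p2 /=.
  by move=> /andP[].
have [v [u [cvu Er H]]] := @coprime_mul_pfactor 7 1 _ _ r 4 isT isT r0 copX EX7.
exists u, v; split; [by rewrite coprime_sym | by rewrite mulnC | ].
have [ov ou] : odd v /\ odd u by apply/andP; rewrite -oddM -Er.
have := @quartic_8_sign_obstruction s u v ou ov.
move: Hd; rewrite Er !expnMn; move: H; rewrite expn1; clear.
by move=> [] [E1 E2] [] E3 bad; first [lia | exfalso; apply: bad; lia].
Qed.

(** Strong induction on [e]: splitting twice gives a solution [(u, v)] with [e = u * v * s]. If
    [v < e], induction yields [u = v = 1], and then [s = 1]; otherwise [u = s = 1], and the
    quadratic equation for [v ^ 2] leaves only [v = 1]. *)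
Lemma quartic_odd_unique M e N : odd M -> odd e -> coprime M e ->
  N ^ 2 + 7 * e ^ 4 = M ^ 4 + 22 * M ^ 2 * e ^ 2 -> M = 1 /\ e = 1.
Proof.
elim/ltn_ind: e M N => e IH M N oM oe cop E.
have e0 : 0 < e by case: e oe {IH cop E}.
have [r [s [crs Ee E1]]] : exists r s, [/\ coprime r s, e = r * s &
    M ^ 2 + 11 * (r * s) ^ 2 = 8 * r ^ 4 + 4 * s ^ 4].
  have [|U [ES EU]] := @sqr_diff_half (M ^ 2 + 11 * e ^ 2) N (32 * e ^ 4).
    by move: E; rewrite !expn4; clear; lia.
  (* The sum of the two factors is [M ^ 2 + 11 * e ^ 2], four times an odd number because odd
     squares are 1 modulo 8, and their product is [32 * e ^ 4]. Twice in a row, an even sum and an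
     even product make both terms even. *)
  have [U' EU' [V' [EV' oUV]]] : exists2 U', U = 4 * U' &
      exists V', U + N = 4 * V' /\ odd (U' + V').
    have [i Ei] := odd_sqr_mod8 oM; have [j Ej] := odd_sqr_mod8 oe.
    have ES4 : U + (U + N) = 4 * (2 * (i + 11 * j + 1) + 1).
      by move: ES; rewrite Ei Ej; clear; lia.
    move: EU ES4; move: (U + N) (e ^ 4) => V C EU ES4.
    have eU : ~~ odd U.
      by have := congr1 odd ES4; have := congr1 odd EU; rewrite oddD !oddM /=;
        case: (odd U); case: (odd V).
    have eV : ~~ odd V.
      by have := congr1 odd ES4; rewrite oddD oddM (negPf eU) /= => ->.
    have [x Ex] := even_double eU; have [y Ey] := even_double eV; subst U V.
    have {}ES4 : x + y = 2 * (2 * (i + 11 * j + 1) + 1) by clear -ES4; lia.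
    have {}EU : x * y = 8 * C by move: EU; clear; lia.
    have ex : ~~ odd x.
      by have := congr1 odd ES4; have := congr1 odd EU; rewrite oddD !oddM /=;
        case: (odd x); case: (odd y).
    have ey : ~~ odd y.
      by have := congr1 odd ES4; rewrite oddD oddM (negPf ex) /= => ->.
    have [U' EU'] := even_double ex; have [V' EV'] := even_double ey; subst x y.
    exists U'; first by rewrite mulnA.
    exists V'; split; first by rewrite mulnA.
    have -> : U' + V' = 2 * (i + 11 * j + 1) + 1 by clear -ES4; lia.
    by rewrite oddD oddM.
  have EUV : U' * V' = 2 * e ^ 4.
    by move: EU; rewrite EV' EU'; move: (e ^ 4); clear; lia.
  have ES' : M ^ 2 + 11 * e ^ 2 = 4 * (U' + V').
    by rewrite ES mulnDr -EU' -EV'; clear; lia.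
  have copU : coprime U' V'.
    apply: coprime_by_primes => p pp pU pV.
    have pS : p %| M ^ 2 + 11 * e ^ 2 by rewrite ES' dvdn_mull // dvdn_addr.
    have : p %| 2 * e ^ 4 by rewrite -EUV dvdn_mulr.
    rewrite Euclid_dvdM // => /orP[|]; last first.
      rewrite Euclid_dvdX // => /andP[pe _].
      move: pS; rewrite dvdn_addl ?Euclid_dvdX ?dvdn_mull ?dvdn_exp //.
      by move=> /andP[pM _]; exact: prime_coprime_absurd cop pM pe.
    rewrite dvdn_prime2 // => /eqP p2.
    by move: oUV; rewrite -[odd _]negbK -dvdn2 -p2 dvdn_addr // pV.
  have [r [s [crs Ee H]]] := @coprime_mul_pfactor 2 1 _ _ e 4 isT isT e0 copU EUV.
  exists r, s; split=> //; rewrite -Ee ES'.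
  by case: H => -[-> ->]; rewrite expn1; clear; lia.
have [or os] : odd r /\ odd s by apply/andP; rewrite -oddM -Ee.
have [u [v [cuv Er E2]]] := quartic_split_8 or crs E1.
have [ou ov] : odd u /\ odd v by apply/andP; rewrite -oddM -Er.
have [u0 v0 s0] : [/\ 0 < u, 0 < v & 0 < s].
  by apply/and3P; move: e0; rewrite Ee Er !muln_gt0 andbA.
have [ve|ev] := ltnP v e.
  have [u1 v1] := IH v ve u _ ou ov cuv E2.
  move: E1 E2; rewrite Ee Er u1 v1; clear -s0 => E1 E2.
  have s1 : s = 1 by nia.
  by split; move: E1; rewrite s1; nia.
have [u1 s1] : u = 1 /\ s = 1.
  move: ev; rewrite Ee Er mulnAC -[X in _ <= X]mul1n leq_pmul2r //.
  by case: u u0 s s0 {IH E Ee Er E1 E2 crs os cuv ou} => [|[|u]] // _ [|[|s]].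
have v1 : v = 1.
  move: E2 ov; rewrite u1 s1 expn4; clear; case: v => [|[|v]] // E _.
  have : 4 <= v.+2 ^ 2 by rewrite (@leq_exp2r 2 _ 2).
  by move: (v.+2 ^ 2) E; clear; nia.
by move: E1; rewrite Ee Er u1 v1 s1; clear; split; nia.
Qed.

(** For odd [M], an odd [e] would make [N ^ 2] equal to 2 modulo 4. So [e] is even, and the
    splitting yields a solution of the dual quartic with [u] odd and [v] even, which
    [no_quartic_even] excludes. *)
Lemma quartic_1_32_even M e N : coprime M e -> 0 < e ->
  N ^ 2 + 11 * (M * e) ^ 2 = M ^ 4 + 32 * e ^ 4 -> ~~ odd M.
Proof.
move=> cop e0 E; apply/negP => oM.
have ee : ~~ odd e.
  apply/negP => /odd_sqr_mod8[j Ej]; have [i Ei] := odd_sqr_mod8 oM.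
  move: E; rewrite !expn4 expnMn Ei Ej; clear.
  have [/odd_sqr_mod8[k ->]|/even_double[k ->]] := boolP (odd N); lia.
have [f Ef] := even_double ee; subst e.
have f0 : 0 < f by move: e0; rewrite muln_gt0.
have [||u [v [cuv Efuv E2]]] := @quartic_split_32 N f M oM f0.
- by rewrite coprime_sym.
- by move: E; rewrite (mulnC M) => ->; rewrite addnC.
have [u0 v0] : 0 < u /\ 0 < v by apply/andP; rewrite -muln_gt0 -Efuv.
have eu : ~~ odd (u + v) -> False.
  move=> euv; have : odd u && odd v.
    move: euv (@prime_coprime_absurd 2 _ _ isT cuv); rewrite !dvdn2 oddD.
    by case: (odd u); case: (odd v) => //= _ /(_ isT isT).
  case/andP=> /odd_sqr_mod8[i Ei] /odd_sqr_mod8[j Ej]; have [k Ek] := odd_sqr_mod8 oM.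
  by move: E2; rewrite !expn4 Ei Ej Ek; clear; lia.
have ouv : odd (u + v) by apply/negP => /negP.
have [f' [s [_ Ev _ _]]] := quartic_split_even ouv v0 cuv E2.
have ev : ~~ odd v by rewrite Ev -mulnA oddM.
by apply: (no_quartic_even _ v0 ev cuv E2); move: ouv; rewrite oddD (negPf ev) addbF.
Qed.

Lemma quartic_8_4_unique r s n : odd r -> coprime r s ->
  n ^ 2 + 11 * (r * s) ^ 2 = 8 * r ^ 4 + 4 * s ^ 4 -> r = 1 /\ s = 1.
Proof.
move=> or cop E; have [u [v [cuv Er E2]]] := quartic_split_8 or cop E.
have [ou ov] : odd u /\ odd v by apply/andP; rewrite -oddM -Er.
have [u1 v1] := quartic_odd_unique ou ov cuv E2.
split; first by rewrite Er u1 v1.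
by move: E2; rewrite u1 v1; clear; nia.
Qed.

(** * From the cubic to the quartics *)

(** The numbers [p], [q] and [F = c * p ^ 2 + d * q ^ 2 - 11 * p * q] are pairwise coprime with
    product [w ^ 2], so each of them is a square. *)
Lemma cubic_coprime_squares c d p q w :
  0 < p -> 0 < q -> coprime p q -> coprime p d -> coprime q c ->
  w ^ 2 + 11 * (p * q) ^ 2 = p * q * (c * p ^ 2 + d * q ^ 2) ->
  exists t e n, [/\ p = t ^ 2, q = e ^ 2, coprime t e &
    n ^ 2 + 11 * (t * e) ^ 2 = c * t ^ 4 + d * e ^ 4].
Proof.
move=> p0 q0 cpq cpd cqc E; have pq0 : 0 < p * q by rewrite muln_gt0 p0.
have [F EF] : exists F, c * p ^ 2 + d * q ^ 2 = 11 * (p * q) + F.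
  exists (c * p ^ 2 + d * q ^ 2 - 11 * (p * q)); rewrite subnKC //.
  by rewrite -(leq_pmul2l pq0) -E mulnCA mulnn leq_addl.
have {}E : w ^ 2 = p * q * F.
  by move: E; rewrite EF mulnDr mulnCA mulnn addnC => /addnI.
have cpF : coprime p F.
  apply: coprime_by_primes => l pl lp lF.
  have : l %| c * p ^ 2 + d * q ^ 2 by rewrite EF dvdn_add // dvdn_mull // dvdn_mulr.
  rewrite dvdn_addr; last by rewrite dvdn_mull ?dvdn_exp.
  rewrite Euclid_dvdM // => /orP[|]; first exact: (prime_coprime_absurd pl cpd lp).
  by rewrite Euclid_dvdX // => /andP[lq _]; exact: (prime_coprime_absurd pl cpq lp lq).
have cqF : coprime q F.
  apply: coprime_by_primes => l pl lq lF.
  have : l %| c * p ^ 2 + d * q ^ 2 by rewrite EF dvdn_add // dvdn_mull // dvdn_mull.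
  rewrite dvdn_addl; last by rewrite dvdn_mull ?dvdn_exp.
  rewrite Euclid_dvdM // => /orP[|]; first exact: (prime_coprime_absurd pl cqc lq).
  rewrite Euclid_dvdX // => /andP[lp _].
  exact: (prime_coprime_absurd pl cpq lp lq).
have [t Et] : exists t, p = t ^ 2.
  by apply: (@coprime_mul_exp p (q * F) w 2); rewrite ?coprimeMr ?cpq // E mulnA.
have [e Ee] : exists e, q = e ^ 2.
  by apply: (@coprime_mul_exp q (p * F) w 2); rewrite ?coprimeMr 1?coprime_sym ?cpq // E mulnCA mulnA.
have [n En] : exists n, F = n ^ 2.
  apply: (@coprime_mul_exp F (p * q) w 2); rewrite ?coprimeMr 1?coprime_sym ?cpF //=.
    by rewrite coprime_sym.
  by rewrite E mulnC.
exists t, e, n; split=> //.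
  by move: cpq; rewrite Et Ee coprime_pexpl // coprime_pexpr.
by rewrite !expn4 -Et -Ee EF -En expnMn -Et -Ee addnC.
Qed.

(* Halving p turns the coefficients (c, 2 d) into (2 c, d); starting from (4, 8)
   this is repeated, for p or symmetrically for q, until p is coprime to d and q
   to c. *)
Lemma cubic_halve c d p q w :
  w ^ 2 + 11 * (2 * p * q) ^ 2 = 2 * p * q * (c * (2 * p) ^ 2 + 2 * d * q ^ 2) ->
  exists w', w' ^ 2 + 11 * (p * q) ^ 2 = p * q * (2 * c * p ^ 2 + d * q ^ 2).
Proof.
move=> E; have /even_double[w' Ew] : ~~ odd w.
  by have := congr1 odd E; rewrite !(oddD, oddM, oddX) /= addbF => ->.
by exists w'; move: E; rewrite Ew !expnMn; clear; lia.
Qed.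

(** Modulo 8, [n ^ 2] would be 7. *)
Lemma odd_quartic_2_16 n t e : odd t -> odd e ->
  n ^ 2 + 11 * (t * e) ^ 2 = 2 * t ^ 4 + 16 * e ^ 4 -> False.
Proof.
move=> /odd_sqr_mod8[i Ei] /odd_sqr_mod8[j Ej].
rewrite !expn4 expnMn Ei Ej; clear.
have [/odd_sqr_mod8[k ->]|/even_double[k ->]] := boolP (odd n); lia.
Qed.

(** The powers of 2 in [p] and [q] decide how often to halve. Coefficients (4, 8) with [p], [q] odd
    give [p = q = 1]; (8, 4), after halving [p] once, gives [p = 2]; (16, 2) fails modulo 8; (32, 1)
    is excluded by [quartic_1_32_even]. An even [q] starts from (8, 4) with the variables
    exchanged. *)
Lemma cubic_points_nat p q w : 0 < p -> 0 < q -> coprime p q ->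
  w ^ 2 + 11 * (p * q) ^ 2 = p * q * (4 * p ^ 2 + 8 * q ^ 2) ->
  q = 1 /\ (p = 1 \/ p = 2).
Proof.
have halves x y : coprime (2 * x) y -> odd y /\ coprime x y.
  by rewrite coprimeMl coprime2n => /andP[].
have odd8 x k : odd x -> coprime x (2 ^ k).
  by move=> ox; rewrite coprime_sym coprimeXl // coprime2n.
have sym c d x y v : v ^ 2 + 11 * (x * y) ^ 2 = x * y * (c * x ^ 2 + d * y ^ 2) ->
    v ^ 2 + 11 * (y * x) ^ 2 = y * x * (d * y ^ 2 + c * x ^ 2).
  by rewrite (mulnC y) (addnC (d * _)).
move=> p0 q0 cpq E; have [oq|/even_double[x Ex]] := boolP (odd q); last first.
  subst q; exfalso; have [op cxp] : odd p /\ coprime x p.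
    by apply: halves; rewrite coprime_sym.
  have x0 : 0 < x by move: q0; rewrite muln_gt0.
  have [w1 E1] := @cubic_halve 8 2 x p w (sym _ _ _ _ _ E).
  have [ox|/even_double[y Ey]] := boolP (odd x).
    have [||e [t [n [Ee Et _ E2]]]] := @cubic_coprime_squares 16 2 _ _ _ x0 p0 cxp _ _ E1.
    - exact: (odd8 _ 1).
    - exact: (odd8 _ 4).
    apply: (@odd_quartic_2_16 n t e).
    - by move: op; rewrite Et oddX.
    - by move: ox; rewrite Ee oddX.
    - by rewrite (mulnC t) E2 addnC.
  subst x; have [_ cyp] := halves _ _ cxp.
  have y0 : 0 < y by move: x0; rewrite muln_gt0.
  (* With [d = 1], both coprimality conditions hold whatever the parity of [y]. *)
  have [w2 E2] := @cubic_halve 16 1 _ _ _ E1.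
  have [||e [t [n [Ee Et cet E3]]]] := @cubic_coprime_squares 32 1 _ _ _ y0 p0 cyp _ _ E2.
  - exact: coprimen1.
  - exact: (odd8 _ 5).
  have := @quartic_1_32_even t e n; rewrite coprime_sym cet (mulnC t) E3 addnC mul1n.
  have e0 : 0 < e by move: y0; rewrite Ee expn_gt0 orbF.
  move=> /(_ isT e0 erefl); apply/negP/negPn.
  by move: op; rewrite Et oddX.
have [op|/even_double[x Ex]] := boolP (odd p).
  have [||t [e [n [Et Ee cte E1]]]] := @cubic_coprime_squares 4 8 _ _ _ p0 q0 cpq _ _ E.
  - exact: (odd8 _ 3).
  - exact: (odd8 _ 2).
  have [||| e1 t1] := @quartic_8_4_unique e t n.
  - by move: oq; rewrite Ee oddX.
  - by rewrite coprime_sym.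
  - by rewrite (mulnC e) E1 addnC.
  by rewrite Et Ee e1 t1; split=> //; left.
subst p; have [_ cxq] := halves _ _ cpq.
have x0 : 0 < x by move: p0; rewrite muln_gt0.
have [w1 E1] := @cubic_halve 4 4 x q w E.
have [ox|/even_double[y Ey]] := boolP (odd x).
  have [||t [e [n [Et Ee cte E2]]]] := @cubic_coprime_squares 8 4 _ _ _ x0 q0 cxq _ _ E1.
  - exact: (odd8 _ 2).
  - exact: (odd8 _ 3).
  have [|t1 e1] := @quartic_8_4_unique t e n _ cte E2.
    by move: ox; rewrite Et oddX.
  by rewrite Et Ee e1 t1; split=> //; right.
exfalso; subst x; have [_ cyq] := halves _ _ cxq.
have y0 : 0 < y by move: x0; rewrite muln_gt0.
have [w2 E2] := @cubic_halve 8 2 _ _ _ E1.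
have [oy|/even_double[z Ez]] := boolP (odd y).
  have [||t [e [n [Et Ee _ E3]]]] := @cubic_coprime_squares 16 2 _ _ _ y0 q0 cyq _ _ E2.
  - exact: (odd8 _ 1).
  - exact: (odd8 _ 4).
  apply: (@odd_quartic_2_16 n e t).
  - by move: oq; rewrite Ee oddX.
  - by move: oy; rewrite Et oddX.
  - by rewrite (mulnC e) E3 addnC.
subst y; have [_ czq] := halves _ _ cyq.
have z0 : 0 < z by move: y0; rewrite muln_gt0.
have [w3 E3] := @cubic_halve 16 1 _ _ _ E2.
have [||t [e [n [Et Ee cte E4]]]] := @cubic_coprime_squares 32 1 _ _ _ z0 q0 czq _ _ E3.
- exact: coprimen1.
- exact: (odd8 _ 5).
have := @quartic_1_32_even e t n; rewrite coprime_sym cte (mulnC e) E4 addnC mul1n.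
have t0 : 0 < t by move: z0; rewrite Et expn_gt0 orbF.
move=> /(_ isT t0 erefl); apply/negP/negPn.
by move: oq; rewrite Ee oddX.
Qed.

(** * Rational points of the curve *)

Import Order.TTheory Num.Theory.
Local Open Scope ring_scope.

(** With [a = p / q] in lowest terms, [v = w * q ^ 2] turns out to be an integer and satisfies the
    equation of [cubic_points_nat]. *)
Lemma cubic_points_rat (a w : rat) :
  w ^+ 2 = 4 * a ^+ 3 - 11 * a ^+ 2 + 8 * a -> a \in [:: 0; 1; 2].
Proof.
move=> E; have [a0|a0|->] := ltrgtP a 0; last by rewrite inE eqxx.
  have : 0 <= w ^+ 2 by rewrite sqr_ge0.
  (* Completing the square shows that the cofactor of [a] is positive, so [a] cannot be negative. *)
  have -> : w ^+ 2 = a * (4 * (a - 11 / 8) ^+ 2 + 7 / 16) by rewrite E; field.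
  have pos : 0 < 4 * (a - 11 / 8) ^+ 2 + 7 / 16 by have := sqr_ge0 (a - 11 / 8); lra.
  by rewrite leNgt nmulr_rlt0 ?pos.
wlog w0 : w E / 0 <= w.
  move=> H; have [w0|w0] := lerP 0 w; first exact: (H w).
  by apply: (H (- w)); rewrite ?sqrrN // oppr_ge0 ltW.
have natfrac (x : rat) : 0 <= x -> exists n d : nat,
    [/\ (0 < d)%N, coprime n d & x = n%:R / d%:R].
  case: (ratP x) => -[n|n] d cop x0; last first.
    move: x0; rewrite leNgt => /negP[].
    by rewrite pmulr_llt0 ?invr_gt0 ?ltr0n // ltrz0.
  by exists n, d.+1.
have [p [q [q0 cpq Ea]]] := natfrac a (ltW a0).
have [m [k [k0 _ Ew]]] := natfrac w w0.
have p0 : (0 < p)%N by case: p Ea {cpq} a0 => // ->; rewrite mul0r.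
have qk : (q%:R != 0 :> rat) /\ (k%:R != 0 :> rat).
  by rewrite !pnatr_eq0 -!lt0n.
have Enat : ((m * q ^ 2) ^ 2 + k ^ 2 * (11 * (p * q) ^ 2) =
    k ^ 2 * (p * q * (4 * p ^ 2 + 8 * q ^ 2)))%N.
  apply/eqP; rewrite -(eqr_nat rat) !(natrD, natrM, natrX).
  case: qk => qr kr; apply/eqP.
  have -> : m%:R = w * k%:R :> rat by rewrite Ew divfK.
  have -> : p%:R = a * q%:R :> rat by rewrite Ea divfK.
  by rewrite !exprMn E; ring.
have /dvdnP[v Ev] : (k %| m * q ^ 2)%N.
  rewrite -(@dvdn_pexp2r _ _ 2) // -(@dvdn_addl (k ^ 2 * (11 * (p * q) ^ 2))) ?(dvdn_mulr _ (dvdnn _)) //.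
  by rewrite Enat dvdn_mulr.
have [|q1 p12] := @cubic_points_nat p q v p0 q0 cpq.
  apply/eqP; rewrite -(@eqn_pmul2l (k ^ 2)) ?expn_gt0 ?k0 // -Enat Ev.
  by rewrite mulnDr (expnMn v) (mulnC (v ^ 2)%N).
by rewrite Ea q1 divr1 !inE; case: p12 => ->; rewrite eqxx ?orbT.
Qed.

Lemma C14_affine_points (a b : rat) :
  2 * a - 3 * a ^+ 2 + a ^+ 3 + a * b - b ^+ 2 = 0 ->
  (a, b) \in [:: (0, 0); (1, 1); (1, 0); (2, 2); (2, 0)].
Proof.
move=> E; have /cubic_points_rat : (2 * b - a) ^+ 2 = 4 * a ^+ 3 - 11 * a ^+ 2 + 8 * a.
  by apply/eqP; rewrite -subr_eq0 -(mulr0 (-4 : rat)) -E; apply/eqP; ring.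
rewrite !inE => /or3P[] /eqP Ea; subst a.
- have /eqP : b ^+ 2 = 0 by rewrite -[RHS]oppr0 -[in RHS]E; ring.
  by rewrite expf_eq0 /= => /eqP->.
- have /eqP : b * (b - 1) = 0 by rewrite -[RHS]oppr0 -[in RHS]E; ring.
  by rewrite mulf_eq0 subr_eq0 => /orP[] /eqP->.
- have /eqP : b * (b - 2) = 0 by rewrite -[RHS]oppr0 -[in RHS]E; ring.
  by rewrite mulf_eq0 subr_eq0 => /orP[] /eqP->.
Qed.

(** * Homogenization of the curve *)

(** The support is known only up to permutation, but neither the sum nor the maximum defining the
    degree depends on the order. *)
Lemma homogenizeE (K : fieldType) (p : {mpoly K[2]}) (r : seq 'X_{1..2}) f :
  uniq r -> {in r, forall m, f m != 0} -> p = \sum_(m <- r) f m *: 'X_[m] ->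
  homogenize p = \sum_(m <- r) f m *: ('X_0 ^+ m 0 * 'X_1 ^+ m 1 *
    'X_2 ^+ ((\max_(m' <- r) (mdeg m').+1).-1 - mdeg m)%N).
Proof.
move=> ur f0 Ep; have sp : perm_eq (msupp p) r by rewrite Ep msupp_sumX.
rewrite /homogenize msizeE !(perm_big _ sp) /= big_seq [RHS]big_seq.
apply: eq_bigr => m mr; congr (_ *: _); rewrite Ep raddf_sum /= (bigD1_seq m) //=.
rewrite mcoeffZ mcoeffX eqxx mulr1 big1_seq ?addr0 // => m' /andP[nm _].
by rewrite mcoeffZ mcoeffX (negPf nm) mulr0.
Qed.

Definition monom2 (ij : nat * nat) : 'X_{1..2} := (U_(0%R) *+ ij.1 + U_(1%R) *+ ij.2)%MM.

Lemma monom2_0 ij : monom2 ij 0%R = ij.1.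
Proof. by rewrite mnmDE !mulmnE !mnm1E /= mul1n mul0n addn0. Qed.

Lemma monom2_1 ij : monom2 ij 1%R = ij.2.
Proof. by rewrite mnmDE !mulmnE !mnm1E /= mul1n mul0n. Qed.

Lemma mdeg_monom2 ij : mdeg (monom2 ij) = (ij.1 + ij.2)%N.
Proof. by rewrite mdegD !mdegMn !mdeg1 !mul1n. Qed.

Lemma monom2_inj : injective monom2.
Proof.
move=> [i j] [k l] E; have := congr1 (fun m : 'X_{1..2} => (m 0%R, m 1%R)) E.
by rewrite !monom2_0 !monom2_1.
Qed.

(** The last branch serves the monomials with exponents (3, 0) and (1, 1). *)
Definition C14_coef (i j : nat) : rat :=
  if (i, j) == (1, 0)%N then 2 else if (i, j) == (2, 0)%N then -3 else
  if (i, j) == (0, 2)%N then -1 else 1.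

Lemma homogenize_C14_eval (v : 'I_3 -> rat) :
  (homogenize C14).@[v] = 2 * v 0 * v 2 ^+ 2 - 3 * v 0 ^+ 2 * v 2 + v 0 ^+ 3
    + v 0 * v 1 * v 2 - v 1 ^+ 2 * v 2.
Proof.
pose r := map monom2 [:: (1, 0); (2, 0); (3, 0); (1, 1); (0, 2)]%N.
rewrite (@homogenizeE _ _ r (fun m => C14_coef (m 0%R) (m 1%R))).
- rewrite /r !big_map !big_cons !big_nil !mdeg_monom2 !monom2_0 !monom2_1 /=.
  rewrite /C14_coef /= !mevalD !mevalZ !mevalM !rmorphXn /= !mevalXU meval0.
  by ring.
- by rewrite map_inj_uniq //; exact: monom2_inj.
- by move=> m /mapP[[i j] _ ->]; rewrite /C14_coef; do ! case: ifP.
- rewrite /r /C14 !big_map !big_cons !big_nil !monom2_0 !monom2_1 /=.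
  rewrite /C14_coef /= /monom2 !mpolyXD -!mpolyXn -!mul_mpolyC !rmorphN !rmorph_nat /=.
  by ring.
Qed.

Lemma ord3P (Q : 'I_3 -> Prop) : Q 0 -> Q 1 -> Q 2 -> forall i, Q i.
Proof.
move=> Q0 Q1 Q2 [[|[|[|//]]] i].
- by rewrite (_ : Ordinal i = 0) //; exact: val_inj.
- by rewrite (_ : Ordinal i = 1) //; exact: val_inj.
- by rewrite (_ : Ordinal i = 2) //; exact: val_inj.
Qed.

(** * Homogeneous coordinates *)

Section ProjectivePoints.
Variable K : fieldType.

Lemma span_scale (V : vectType K) (k : K) (v : V) : k != 0 -> (<[k *: v]> = <[v]>)%VS.
Proof.
move=> k0; apply/eqP; rewrite eqEsubv -!memvE memvZ ?memv_line //=.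
by rewrite -{1}(scalerK k0 v) memvZ ?memv_line.
Qed.

Lemma row3_inj (u v : 'rV[K]_3) :
  u 0 0 = v 0 0 -> u 0 1 = v 0 1 -> u 0 2 = v 0 2 -> u = v.
Proof.
by move=> h0 h1 h2; apply/rowP; apply: ord3P.
Qed.

Lemma line_hcoord (v : 'rV[K]_3) : <[v]>%VS = hcoord (v 0 0) (v 0 1) (v 0 2).
Proof. by congr <[_]>%VS; apply: row3_inj; rewrite !mxE. Qed.

Lemma hcoord_scale (k a b c : K) : k != 0 -> hcoord (k * a) (k * b) (k * c) = hcoord a b c.
Proof.
move=> k0; rewrite /hcoord -[RHS](span_scale _ k0); congr <[_]>%VS.
by apply: row3_inj; rewrite !mxE.
Qed.

Lemma ppointP (P : ppoint K) : exists2 v : 'rV[K]_3, v != 0 & val P = <[v]>%VS.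
Proof.
have dP := eqP (valP P); have P0 : val P != 0%VS by rewrite -dimv_eq0 dP.
exists (vpick (val P)); first by rewrite vpick0.
by apply/eqP; rewrite eq_sym eqEdim -memvE memv_pick dim_vline vpick0 P0 dP.
Qed.

End ProjectivePoints.

Lemma C14_projective_points (P : ppoint rat) :
  on_projective_closure C14 P <->
  val P \in [:: hcoord 0 0 1; hcoord 1 1 1; hcoord 1 0 1;
                hcoord 2 2 1; hcoord 2 0 1; hcoord 0 1 0].
Proof.
split; last first.
  move=> inP v; have [a [b [c [EP E]]]] : exists a b c, val P = hcoord a b c /\
      2 * a * c ^+ 2 - 3 * a ^+ 2 * c + a ^+ 3 + a * b * c - b ^+ 2 * c = 0.
    by move: inP; rewrite !inE => /or4P[| | |/or3P[]] /eqP->;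
      do 3! eexists; (split; [reflexivity | ring]).
  (* Every vector of [P] is [k] times the representative, and the form is homogeneous of degree
     3. *)
  rewrite EP => /vlineP[k ->]; rewrite homogenize_C14_eval !mxE /=.
  by rewrite -[RHS](mulr0 (k ^+ 3)) -E; ring.
have [v v0 EP] := ppointP P => onP.
have vP : v \in val P by rewrite EP memv_line.
move: (onP v vP); rewrite EP homogenize_C14_eval line_hcoord; move: v0; have := @row3_inj _ v 0.
rewrite !mxE; move: (v 0 0) (v 0 1) (v 0 2) => a b c vE v0 E.
(* On the line at infinity the form reduces to [a ^+ 3], which leaves (0 : 1 : 0). *)
have [c0|c0] := eqVneq c 0.
  have /eqP : a ^+ 3 = 0 by rewrite -E c0; ring.
  rewrite expf_eq0 /= => /eqP a0; have b0 : b != 0.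
    by apply: contraNneq v0 => b0; apply/eqP/vE.
  have -> : hcoord a b c = hcoord (b * 0) (b * 1) (b * 0) by rewrite a0 c0 mulr0 mulr1.
  by rewrite hcoord_scale // !inE eqxx !orbT.
have -> : hcoord a b c = hcoord (a / c) (b / c) 1.
  by rewrite -[RHS](hcoord_scale _ _ _ c0) mulr1 ![c * _]mulrC !divfK.
have /C14_affine_points : 2 * (a / c) - 3 * (a / c) ^+ 2 + (a / c) ^+ 3
    + (a / c) * (b / c) - (b / c) ^+ 2 = 0.
  by rewrite -[RHS](mul0r (c ^- 3)) -E; field.
by rewrite !inE => /or4P[| | |/orP[]] /eqP[-> ->]; rewrite eqxx ?orbT.
Qed.

(** * Normal vectors of the lines *)

Section Normals.
Variable K : fieldType.
Implicit Types (u v w : 'cV[K]_3) (L : pline K) (P : ppoint K).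

Definition cols3 u v w : 'M[K]_3 := \matrix_(i, j) [:: u; v; w]`_j i 0.

Definition D3 u v w : K := \det (cols3 u v w).

Lemma mul_cols3 (C : 'M[K]_3) u v w :
  cols3 (C *m u) (C *m v) (C *m w) = C *m cols3 u v w.
Proof.
apply/matrixP => i; apply: ord3P; rewrite !mxE /=;
  by apply: eq_bigr => k _; rewrite !mxE.
Qed.

Lemma D3_mul (C : 'M[K]_3) u v w : D3 (C *m u) (C *m v) (C *m w) = \det C * D3 u v w.
Proof. by rewrite /D3 mul_cols3 det_mulmx. Qed.

Lemma D3E u v w : D3 u v w =
  u 0 0 * (v 1 0 * w 2 0 - v 2 0 * w 1 0) - u 1 0 * (v 0 0 * w 2 0 - v 2 0 * w 0 0)
  + u 2 0 * (v 0 0 * w 1 0 - v 1 0 * w 0 0).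
Proof.
have e1 : lift 0 0 = 1 :> 'I_3 by exact: val_inj.
have e2 : lift 0 (lift 0 0) = 2 :> 'I_3 by exact: val_inj.
have e3 : lift 1 0 = 0 :> 'I_3 by exact: val_inj.
have e4 : lift 1 (lift 0 0) = 2 :> 'I_3 by exact: val_inj.
have e5 : lift 2 0 = 0 :> 'I_3 by exact: val_inj.
have e6 : lift 2 (lift 0 0) = 1 :> 'I_3 by exact: val_inj.
have e7 : lift (lift ord0 ord0) 0 = 0 :> 'I_2 by exact: val_inj.
rewrite /D3 (expand_det_col _ 0) !big_ord_recl big_ord0 /cofactor.
rewrite !(expand_det_col _ 0) !big_ord_recl !big_ord0 /cofactor !det_mx11 !mxE /=.
rewrite !e7 ?(e1, e2, e3, e4, e5, e6).
by rewrite /bump /=; ring.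
Qed.

(** Concurrency criterion: [p] spans a common point of the lines with normals [u], [v], [w]. *)
Lemma D3_eq0P u v w :
  reflect (exists2 p : 'rV[K]_3, p != 0 & [/\ p *m u = 0, p *m v = 0 & p *m w = 0])
    (D3 u v w == 0).
Proof.
have colE (p : 'rV_3) j : (p *m cols3 u v w) 0 j = (p *m [:: u; v; w]`_j) 0 0.
  by rewrite !mxE; apply: eq_bigr => k _; rewrite !mxE.
rewrite /D3; apply: (iffP det0P) => -[p p0 H]; exists p => //.
  split; apply/matrixP => i j; rewrite !ord1 [RHS]mxE.
  - by rewrite -(colE p 0) H mxE.
  - by rewrite -(colE p 1) H mxE.
  - by rewrite -(colE p 2) H mxE.
case: H => hu hv hw; apply/rowP; apply: ord3P.
- by rewrite (colE p) hu !mxE.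
- by rewrite (colE p) hv !mxE.
- by rewrite (colE p) hw !mxE.
Qed.

Lemma line_normal L : exists n : 'cV[K]_3, forall p, (p \in val L) = (p *m n == 0).
Proof.
have dL := eqP (valP L); pose b := vbasis (val L).
(* The zero third column makes the determinant vanish and provides a vector orthogonal to both basis
   vectors. *)
have /D3_eq0P[m m0 [mb0 mb1 _]] : D3 (b`_0)^T (b`_1)^T 0 == 0.
  by rewrite D3E !mxE; apply/eqP; ring.
have mnE (p : 'rV[K]_3) : m *m p^T = 0 -> p *m m^T = 0.
  by move=> E; rewrite -[p]trmxK -trmx_mul E trmx0.
pose f : 'Hom('rV[K]_3, 'rV[K]_1) := linfun (mulmxr m^T).
have fE p : f p = p *m m^T by rewrite lfunE.
exists m^T => p; suff -> : val L = lker f by rewrite memv_ker fE.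
apply/eqP; rewrite eqEdim; apply/andP; split.
  apply/subvP => u /coord_vbasis ->; rewrite memv_ker fE mulmx_suml big1 // => i _.
  rewrite -scalemxAl mnE ?scaler0 //.
  have := ltn_ord i; rewrite [X in (_ < X)%N]dL.
  by case: (nat_of_ord i) => [|[|]].
(* A nonzero functional has a kernel of dimension at most 2, so the kernel is no larger than [L]. *)
have f0 : (0 < \dim (f @: fullv))%N.
  rewrite lt0n dimv_eq0; apply: contraNneq m0 => f0; apply/eqP/rowP => i.
  have : f (delta_mx 0 i) \in (f @: fullv)%VS by rewrite memv_img ?memvf.
  rewrite f0 memv0 fE -rowE => /eqP/matrixP/(_ 0 0).
  by rewrite !mxE.
have d3 : (\dim (lker f) + \dim (limg f) = 3)%N.
  by have := limg_ker_dim f fullv; rewrite capfv dimvf dim_matrix.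
rewrite dL.
by rewrite -(leq_add2r (\dim (f @: fullv))) d3 -[3%N]/(2 + 1)%N leq_add2l.
Qed.

(** Distinct lines meet in dimension at most 1, so [P] and the span of [p] both equal the
    intersection. *)
Lemma on_two_lines L L' P (p : 'rV[K]_3) : L != L' -> p != 0 ->
  p \in val L -> p \in val L' -> on_line P L -> on_line P L' -> val P = <[p]>%VS.
Proof.
move=> nL p0 pL pL' PL PL'.
have d1 : (\dim (val L :&: val L') <= 1)%N.
  rewrite leqNgt; apply: contra nL => d2.
  have sub (M M' : pline K) : (1 < \dim (val M :&: val M'))%N -> (val M <= val M')%VS.
    move=> d; suff /eqP <- : (val M :&: val M' == val M)%VS by exact: capvSr.
    by rewrite eqEdim capvSl (eqP (valP M)).
  apply/eqP/val_inj/eqP; rewrite eqEsubv sub //=.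
  by apply: sub; rewrite capvC.
have capE (U : {vspace 'rV[K]_3}) : \dim U = 1%N -> (U <= val L)%VS -> (U <= val L')%VS ->
    U = (val L :&: val L')%VS.
  by move=> dU UL UL'; apply/eqP; rewrite eqEdim subv_cap UL UL' dU.
rewrite (capE _ (eqP (valP P)) PL PL') [RHS]capE -?memvE //.
by rewrite dim_vline p0.
Qed.

Variable n : nat.

(** Ordered triples instead of sets: on concrete indices the condition evaluates, so [isT] proves
    it. *)
Definition zero_sum3 (i j k : 'I_n) : bool :=
  uniq [:: i; j; k] && (n %| i + j + k)%N.

Lemma zero_sum3_triple (i j k : 'I_n) :
  zero_sum3 i j k -> [set i; j; k] \in zero_triples n.
Proof.
rewrite /zero_sum3 /= !inE andbT negb_or => /andP[/andP[/andP[ij ik] jk] d].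
apply/andP; split.
  by rewrite -setUA !cardsU1 !inE cards1 negb_or ij ik jk.
rewrite -setUA big_setU1 ?inE ?negb_or ?ij //= big_setU1 ?inE //= big_set1.
by rewrite addnA.
Qed.

(** For the second claim, a common point of [L i], [L j], [L l] would be both the meet of [L i],
    [L j] and that of [L i], [L l], so the distinct triples [{i, j, k}] and [{i, l, m}] would share
    their point. *)
Lemma boroczky_normals (L : 'I_n -> pline K) : boroczky_config L ->
  exists N : 'I_n -> 'cV[K]_3,
    (forall i j k, zero_sum3 i j k -> D3 (N i) (N j) (N k) = 0) /\
    (forall i j l k m, [&& zero_sum3 i j k, zero_sum3 i l m & l \notin [:: j; k]] ->
      D3 (N i) (N j) (N l) != 0).
Proof.
move=> [injL [P [incP injP]]].
have [N NE] := fin_all_exists (fun i => line_normal (L i)).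
exists N; split=> [i j k /zero_sum3_triple T0 | i j l k m /and3P[zijk zilm ljk]].
  have [p p0 EP] := ppointP (P [set i; j; k]).
  have on x : x \in [set i; j; k] -> p *m N x = 0.
    by move=> xT; apply/eqP; rewrite -NE memvE -EP; exact: incP T0 _ xT.
  apply/eqP/D3_eq0P; exists p => //.
  by rewrite !on ?inE ?eqxx ?orbT.
have [T0 T0'] := (zero_sum3_triple zijk, zero_sum3_triple zilm).
have ij : i != j by case/andP: zijk => /and3P[]; rewrite !inE negb_or => /andP[].
have il : i != l by case/andP: zilm => /and3P[]; rewrite !inE negb_or => /andP[].
apply/D3_eq0P => -[p p0 [/eqP pi /eqP pj /eqP pl]].
have nLL x y : x != y -> L x != L y by rewrite (inj_eq injL).
have EP : val (P [set i; j; k]) = <[p]>%VS.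
  apply: (on_two_lines (nLL _ _ ij) p0); rewrite ?NE //;
    by apply: incP T0 _ _; rewrite !inE eqxx ?orbT.
have EP' : val (P [set i; l; m]) = <[p]>%VS.
  apply: (on_two_lines (nLL _ _ il) p0); rewrite ?NE //;
    by apply: incP T0' _ _; rewrite !inE eqxx ?orbT.
have /setP/(_ l) := injP _ _ T0 T0' (val_inj (etrans EP (esym EP'))).
by move: ljk; rewrite !inE -orbA (eq_sym l i) (negPf il) => /negPf->; rewrite eqxx orbT.
Qed.

End Normals.

(** * Projective frames *)

Section Frame.
Variable K : fieldType.

(** With [c] the coordinates of [u7] in the basis [u1], [u2], [u3], the matrix [C] passes to that
    basis and divides the coordinates by those of [c]. By Cramer's rule the last three determinants
    make them nonzero. *)
Lemma frame_coordinates (u1 u2 u3 u7 : 'cV[K]_3) :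
  D3 u1 u2 u3 != 0 -> D3 u7 u2 u3 != 0 -> D3 u1 u7 u3 != 0 -> D3 u1 u2 u7 != 0 ->
  exists2 C : 'M[K]_3, \det C != 0 &
    [/\ [/\ (C *m u1) 1 0 = 0 & (C *m u1) 2 0 = 0],
        [/\ (C *m u2) 0 0 = 0 & (C *m u2) 2 0 = 0],
        [/\ (C *m u3) 0 0 = 0 & (C *m u3) 1 0 = 0] & forall i, (C *m u7) i 0 = 1].
Proof.
move=> d0; pose Q := cols3 u1 u2 u3; have uQ : Q \in unitmx by rewrite unitmxE unitfE.
pose e (i : 'I_3) : 'cV[K]_3 := delta_mx i 0.
have Qe i : Q *m e i = [:: u1; u2; u3]`_i.
  by rewrite -colE; apply/colP => j; rewrite !mxE.
have [c Qc] : exists c, Q *m c = u7 by exists (invmx Q *m u7); rewrite mulKVmx.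
have Q0 : Q *m e 0 = u1 := Qe 0; have Q1 : Q *m e 1 = u2 := Qe 1.
have Q2 : Q *m e 2 = u3 := Qe 2.
rewrite -Qc -Q0 -Q1 -Q2 !D3_mul !mulf_eq0 !negb_or.
move=> /andP[_ c0] /andP[_ c1] /andP[_ c2].
have cN : forall i, c i 0 != 0.
  apply: ord3P; [move: c0 | move: c1 | move: c2];
    by apply: contraNneq => ci; rewrite D3E !mxE /= ci; apply/eqP; ring.
pose C := diag_mx (\row_i (c i 0)^-1) *m invmx Q.
have CE v i : (C *m v) i 0 = (c i 0)^-1 * (invmx Q *m v) i 0.
  by rewrite -mulmxA mul_diag_mx !mxE.
exists C.
  rewrite det_mulmx det_diag det_inv mulf_neq0 ?invr_eq0 //.
  by apply/prodf_neq0 => i _; rewrite mxE invr_eq0.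
by split=> [|||i]; rewrite !CE ?mulKmx ?mxE ?mulr0 // mulVf.
Qed.

End Frame.

(** * Coordinates for the configuration of 14 lines *)

Local Notation o k := (@Ordinal 14 k isT).

Section Parametrization.
Variable K : fieldType.
Variables x y z : 'I_14 -> K.
Let D i j k := x i * (y j * z k - z j * y k) - y i * (x j * z k - z j * x k)
  + z i * (x j * y k - y j * x k).
Hypothesis collinear : forall i j k : 'I_14, zero_sum3 i j k -> D i j k = 0.
Hypothesis noncollinear : forall i j l k m : 'I_14,
  [&& zero_sum3 i j k, zero_sum3 i l m & l \notin [:: j; k]] -> D i j l != 0.
Hypothesis frame1 : y (o 1) = 0 /\ z (o 1) = 0.
Hypothesis frame2 : x (o 2) = 0 /\ z (o 2) = 0.
Hypothesis frame3 : x (o 3) = 0 /\ y (o 3) = 0.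
Hypothesis frame7 : [/\ x (o 7) = 1, y (o 7) = 1 & z (o 7) = 1].

(** Below, [d] is the vanishing determinant of a zero triple, [c] collects its factors known to be
    nonzero, and [e] is the relation gained. *)
Let cancel (c e d : K) : c != 0 -> d = 0 -> d = c * e -> e = 0.
Proof. by move=> c0 -> /esym/eqP; rewrite mulf_eq0 (negPf c0) => /eqP. Qed.

(* Up to scalars, with q_k the coordinate vector of index k:
     q_4 = (a, a, 1+a)            q_11 = (1, b, 0)       q_9 = (0, a, 1+a)
     q_8 = (a, a(1+b), 1+a)       q_5 = (1+a, a(1+b), 1+a)
     q_0 = (a, ab, b)             q_6 = (1+a, a(1+b), a(1+b)).
   The scalars are t4, x (o 11), t9, t8, t5, t0, t6. *)
Lemma boroczky14_parameters : exists a b : K,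
  [/\ a != 0, a != -1, a != 1 & a ^+ 2 * b + a * b - a - b ^+ 2 = 0].
Proof.
have [y1 z1] := frame1; have [x2 z2] := frame2; have [x3 y3] := frame3.
have [x7 y7 z7] := frame7.
have s1 : x (o 1) != 0.
  (* The last two indices complete the zero triples: 1 + 2 + 11 = 1 + 3 + 10 = 14. *)
  apply: contraNneq (@noncollinear (o 1) (o 2) (o 3) (o 11) (o 10) isT).
  by rewrite /D y1 z1 => ->; apply/eqP; ring.
have s2 : y (o 2) != 0.
  apply: contraNneq (@noncollinear (o 1) (o 2) (o 3) (o 11) (o 10) isT).
  by rewrite /D x2 z2 => ->; apply/eqP; ring.
have s3 : z (o 3) != 0.
  apply: contraNneq (@noncollinear (o 1) (o 2) (o 3) (o 11) (o 10) isT).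
  by rewrite /D x3 y3 => ->; apply/eqP; ring.
have x4 : x (o 4) = y (o 4).
  apply/eqP; rewrite -subr_eq0; apply/eqP.
  apply: (cancel s3 (@collinear (o 3) (o 4) (o 7) isT)).
  by rewrite /D x3 y3 x7 y7 z7; ring.
(* Scaling by this difference brings q_4, whose first two coordinates agree, to the form (a, a, 1 +
   a). *)
pose t4 := z (o 4) - y (o 4).
have t4N : t4 != 0.
  apply: contraNneq (@noncollinear (o 7) (o 1) (o 4) (o 6) (o 3) isT) => t0.
  apply/eqP; rewrite /D x7 y7 z7 y1 z1; transitivity (- x (o 1) * t4).
    by rewrite /t4; ring.
  by rewrite t0 mulr0.
pose a := y (o 4) / t4.
have y4 : y (o 4) = a * t4 by rewrite divfK.
have z4 : z (o 4) = (1 + a) * t4 by rewrite mulrDl -y4 /t4; ring.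
have a0 : a != 0.
  apply: contraNneq (@noncollinear (o 3) (o 1) (o 4) (o 10) (o 7) isT) => a0.
  by rewrite /D x3 y3 y1 z1 y4 a0; apply/eqP; ring.
have a1 : 1 + a != 0.
  apply: contraNneq (@noncollinear (o 1) (o 2) (o 4) (o 11) (o 9) isT) => a1.
  by rewrite /D x2 y1 z1 z2 z4 a1; apply/eqP; ring.
have z11 : z (o 11) = 0.
  apply: (cancel (mulf_neq0 s1 s2) (@collinear (o 1) (o 2) (o 11) isT)).
  by rewrite /D x2 y1 z1 z2; ring.
have t11 : x (o 11) != 0.
  apply: contraNneq (@noncollinear (o 2) (o 3) (o 11) (o 9) (o 1) isT) => h.
  by rewrite /D x2 z2 x3 y3 h z11; apply/eqP; ring.
pose b := y (o 11) / x (o 11).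
have y11 : y (o 11) = b * x (o 11) by rewrite divfK.
have x9 : x (o 9) = 0.
  apply: (cancel (mulf_neq0 s2 s3) (@collinear (o 2) (o 3) (o 9) isT)).
  by rewrite /D x2 z2 x3 y3; ring.
have z9 : z (o 9) = (1 + a) * (y (o 9) / a).
  apply: (mulfI a0); apply/eqP; rewrite -subr_eq0; apply/eqP.
  apply: (cancel (mulf_neq0 s1 t4N) (@collinear (o 1) (o 4) (o 9) isT)).
  by rewrite /D y1 z1 x4 x9 y4 z4; field.
pose t9 := y (o 9) / a.
have t9N : t9 != 0.
  apply: contraNneq (@noncollinear (o 1) (o 2) (o 9) (o 11) (o 4) isT) => h.
  by rewrite /D x2 z2 y1 z1 z9 -/t9 h; apply/eqP; ring.
have y9 : y (o 9) = a * t9 by rewrite mulrC divfK.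
move: z9; rewrite -/t9 => z9.
pose t8 := x (o 8) / a.
have x8 : x (o 8) = a * t8 by rewrite mulrC divfK.
have z8 : z (o 8) = (1 + a) * t8.
  apply: (mulfI a0); apply/eqP; rewrite -subr_eq0; apply/eqP.
  apply: (cancel (mulf_neq0 s2 t4N) (@collinear (o 4) (o 2) (o 8) isT)).
  by rewrite /D x2 z2 x4 y4 z4 x8; ring.
have t8N : t8 != 0.
  apply: contraNneq (@noncollinear (o 2) (o 1) (o 8) (o 11) (o 4) isT) => h.
  by rewrite /D x2 z2 y1 z1 z8 h; apply/eqP; ring.
have y8 : y (o 8) = a * (1 + b) * t8.
  apply/eqP; rewrite -subr_eq0; apply/eqP.
  apply: (cancel (mulf_neq0 (mulf_neq0 a1 t9N) t11) (@collinear (o 9) (o 11) (o 8) isT)).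
  by rewrite /D x9 y9 z9 y11 z11 x8 z8; ring.
pose t5 := x (o 5) / (1 + a).
have x5 : x (o 5) = (1 + a) * t5 by rewrite mulrC divfK.
have z5 : z (o 5) = (1 + a) * t5.
  rewrite -x5; apply/eqP; rewrite -subr_eq0; apply/eqP.
  apply: (cancel s2 (@collinear (o 7) (o 2) (o 5) isT)).
  by rewrite /D x7 y7 z7 x2 z2; ring.
have t5N : t5 != 0.
  apply: contraNneq (@noncollinear (o 2) (o 3) (o 5) (o 9) (o 7) isT) => h.
  by rewrite /D x2 z2 x3 y3 x5 h; apply/eqP; ring.
have y5 : y (o 5) = a * (1 + b) * t5.
  apply: (mulfI a1); apply/eqP; rewrite -subr_eq0; apply/eqP.
  apply: (cancel (mulf_neq0 s1 t8N) (@collinear (o 1) (o 5) (o 8) isT)).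
  by rewrite /D y1 z1 y8 z8 z5; ring.
pose t0 := x (o 0) / a.
have x0 : x (o 0) = a * t0 by rewrite mulrC divfK.
have y0 : y (o 0) = a * b * t0.
  apply/eqP; rewrite -subr_eq0; apply/eqP.
  apply: (cancel (mulf_neq0 s3 t11) (@collinear (o 3) (o 11) (o 0) isT)).
  by rewrite /D x3 y3 y11 x0; ring.
have z0 : z (o 0) = b * t0.
  apply/eqP; rewrite -subr_eq0; apply/eqP.
  apply: (cancel (mulf_neq0 (mulf_neq0 (mulf_neq0 a1 a0) t5N) t9N) (@collinear (o 5) (o 9) (o 0) isT)).
  by rewrite /D x5 y5 z5 x9 y9 z9 x0 y0; ring.
have t0N : t0 != 0.
  apply: contraNneq (@noncollinear (o 2) (o 3) (o 0) (o 9) (o 12) isT) => h.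
  by rewrite /D x2 z2 x3 y3 x0 h; apply/eqP; ring.
pose t6 := x (o 6) / (1 + a).
have x6 : x (o 6) = (1 + a) * t6 by rewrite mulrC divfK.
have y6 : y (o 6) = a * (1 + b) * t6.
  apply: (mulfI a1); apply/eqP; rewrite -subr_eq0; apply/eqP.
  apply: (cancel (mulf_neq0 s3 t5N) (@collinear (o 3) (o 5) (o 6) isT)).
  by rewrite /D x3 y3 x5 y5 x6; ring.
have z6 : z (o 6) = a * (1 + b) * t6.
  rewrite -y6; apply/eqP; rewrite -subr_eq0; apply/eqP.
  apply: (cancel s1 (@collinear (o 1) (o 7) (o 6) isT)).
  by rewrite /D y1 z1 x7 y7 z7; ring.
have t6N : t6 != 0.
  apply: contraNneq (@noncollinear (o 3) (o 7) (o 6) (o 4) (o 5) isT) => h.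
  by rewrite /D x3 y3 x6 y6 z6 h; apply/eqP; ring.
exists a, b; split=> //; first by apply: contraNneq a1 => ->; rewrite subrr.
  (* For [a = 1] the last two coordinates of q_0 agree, as do those of q_7, so q_0, q_1, q_7 would
     be dependent. *)
  apply: contraNneq (@noncollinear (o 1) (o 0) (o 7) (o 13) (o 6) isT) => h.
  by rewrite /D y1 z1 x7 y7 z7 y0 z0 h; apply/eqP; ring.
apply: (cancel (mulf_neq0 (mulf_neq0 (mulf_neq0 a0 t0N) t8N) t6N)
  (@collinear (o 0) (o 8) (o 6) isT)).
by rewrite /D x0 y0 z0 x8 y8 z8 x6 y6 z6; ring.
Qed.

End Parametrization.

(** The change of frame multiplies every [D3] by the nonzero [\det C], so it preserves dependence
    and independence of the normals. *)
Lemma boroczky14_curve (K : fieldType) (L : 'I_14 -> pline K) : boroczky_config L ->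
  exists a b : K, [/\ a != 0, a != -1, a != 1 & a ^+ 2 * b + a * b - a - b ^+ 2 = 0].
Proof.
move=> /boroczky_normals[N [colN ncolN]].
have [||||C C0 [f1 f2 f3 f7]] :=
    @frame_coordinates _ (N (o 1)) (N (o 2)) (N (o 3)) (N (o 7)).
- exact: (ncolN _ _ _ (o 11) (o 10)).
- exact: (ncolN _ _ _ (o 5) (o 4)).
- exact: (ncolN _ _ _ (o 6) (o 10)).
- exact: (ncolN _ _ _ (o 11) (o 6)).
pose x i := (C *m N i) 0 0; pose y i := (C *m N i) 1 0; pose z i := (C *m N i) 2 0.
apply: (@boroczky14_parameters K x y z) => //.
- by move=> i j k T; rewrite -[LHS](D3E (C *m N i) (C *m N j) (C *m N k)) D3_mul colN ?mulr0.
- move=> i j l k m T.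
  rewrite -[X in X != 0](D3E (C *m N i) (C *m N j) (C *m N l)) D3_mul mulf_neq0 //.
  exact: ncolN T.
by split; exact: f7.
Qed.

(* The discriminant of the curve as a quadratic in b is a^4 (4s^3 - 11s^2 + 8s)
   with s = 1 - 1/a. *)
Lemma no_boroczky14_rat (L : 'I_14 -> pline rat) : ~ boroczky_config L.
Proof.
move=> /boroczky14_curve[a [b [a0 aN1 a1 E]]].
have : ((2 * b - a ^+ 2 - a) / a ^+ 2) ^+ 2 =
    4 * (1 - a^-1) ^+ 3 - 11 * (1 - a^-1) ^+ 2 + 8 * (1 - a^-1).
  apply/eqP; rewrite -subr_eq0 -(mulr0 (- 4 / a ^+ 4)) -E; apply/eqP; field.
  exact: a0.
(* The values 0, 1, 2 of [1 - a^-1] mean that [a^-1] is 1, 0 or -1. *)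
move=> /cubic_points_rat; rewrite !inE => /or3P[]; rewrite subr_eq.
- by rewrite add0r eq_sym invr_eq1 (negPf a1).
- by rewrite addrC -subr_eq subrr eq_sym invr_eq0 (negPf a0).
rewrite addrC -subr_eq -[1 - 2]/(-1 : rat) => /eqP aV.
by move: aN1; rewrite -[a]invrK -aV invrN invr1 eqxx.
Qed.

Theorem mainTheorem4 :
  (forall P : ppoint rat,
     on_projective_closure C14 P <->
     val P \in [:: hcoord 0 0 1; hcoord 1 1 1; hcoord 1 0 1;
                   hcoord 2 2 1; hcoord 2 0 1; hcoord 0 1 0]) /\
  ~ (exists L : 'I_14 -> pline rat, boroczky_config L).
Proof.
split; first exact: C14_projective_points.
by case=> L; exact: no_boroczky14_rat.
Qed.
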